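(* Let $n,d\ge2$ with $n\ge d-1$. The total number of $(d-1)$-plateaux, summed over all $\Pi\in S^d_n$, equals \[(n-d+2)\,(d-1)!\,\big((n-d+1)!\big)^{d-1}\sum_{\ell=0}^{n-1}\big(A(\ell,d-2)\big)^{d-1},\] where $A(m,k)=\frac{m!}{(m-k)!}$ if $0\le k\le m$ and $A(m,k)=0$ otherwise.
   Context: For $n\ge1$, $S_n$ is the set of permutations of $\{0,\dots,n-1\}$ in one-line notation. For $d\ge2$, $S^d_n$ is the set of $(d-1)$-tuples $\Pi=(\pi^2,\dots,\pi^d)$ of elements of $S_n$; its elements are the columns $\Pi_j=(\pi^2_j,\dots,\pi^d_j)^T$, with level $\mathrm{lev}(\Pi_j)=\max\{\pi^2_j,\dots,\pi^d_j\}$. A $(d-1)$-plateau of $\Pi$ (occurrence of the consecutive pattern $\underline{11\cdots1}$ with $d-1$ ones) is an index $i$ with $1\le i\le n-d+2$ such that $\mathrm{lev}(\Pi_i)=\mathrm{lev}(\Pi_{i+1})=\dots=\mathrm{lev}(\Pi_{i+d-2})$. *)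

(* Defs.v *)
From mathcomp Require Import all_boot all_fingroup.

Set Implicit Arguments.
Unset Strict Implicit.
Unset Printing Implicit Defensive.

(* Positions are counted from 0, so that the columns of Pi are Pi_0 ... Pi_(n-1);
   k : 'I_(d - 1) stands for the row pi^(k+2). *)
Notation multiperm d n := {ffun 'I_(d - 1) -> 'S_n}.

Definition column d n (Pi : multiperm d n) (j : 'I_n) : {ffun 'I_(d - 1) -> 'I_n} :=
  [ffun k => Pi k j].

Definition lev d n (c : {ffun 'I_(d - 1) -> 'I_n}) : nat :=
  \max_(k < d - 1) c k.

(* The chain lev(Pi_i) = ... = lev(Pi_(i+d-2)), as equality of any two of its terms. *)
Definition plateau_at d n (Pi : multiperm d n) (i : nat) : bool :=
  [forall j : 'I_n, forall j' : 'I_n,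
    (i <= j < i + (d - 1)) && (i <= j' < i + (d - 1)) ==>
    (lev (column Pi j) == lev (column Pi j'))].

(* The starting index ranges over n - d + 2 values; this is written n + 2 - d
   because natural subtraction is truncated and d may equal n + 1. *)
Definition nb_plateaux d n (Pi : multiperm d n) : nat :=
  #|[set i : 'I_(n + 2 - d) | plateau_at Pi i]|.

Definition arr (m k : nat) : nat :=
  if k <= m then m`! %/ (m - k)`! else 0.

Lemma arrE m k : arr m k = m ^_ k.
Proof.
rewrite /arr; case: leqP => [le_km | lt_mk]; first by rewrite ffact_factd.
by rewrite ffact_small.
Qed.

(* Main.v *)
Require Import Defs.
From mathcomp Require Import all_boot all_fingroup.

Set Implicit Arguments.
Unset Strict Implicit.
Unset Printing Implicit Defensive.

(* Fix a window of d - 1 consecutive positions and a common level l for its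
   columns. Each of the d - 1 columns must contain l, and each of the d - 1 rows
   contains l exactly once, so the occurrences of l in the window form a
   permutation matrix: there are (d - 1)! choices for it. Given this choice the
   rows are independent, and each one is a permutation sending a prescribed
   position to l and the d - 2 other positions of the window below l, which
   leaves A(l, d - 2) (n - d + 1)! possibilities. *)

(** At most one summand is nonzero. This turns an existential with a unique witness into a sum,
    which can then be exchanged with another sum. *)
Lemma sum_pred_exists (I : finType) (P : pred I) :
  (forall i j, P i -> P j -> i = j) ->
  \sum_(i : I) (P i : nat) = [exists i, P i].
Proof.
move=> P_uniq; case: existsP => [[i Pi] | noP].
  rewrite (bigD1 i) //= Pi big1 // => j neq_ji.
  by case Pj: (P j) => //; rewrite (P_uniq j i) ?eqxx in neq_ji.
by rewrite big1 // => i _; case Pi: (P i) => //; case: noP; exists i.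
Qed.

Lemma perm_map_exists (T : finType) (xs ys : seq T) :
  uniq xs -> uniq ys -> size xs = size ys ->
  exists s : {perm T}, map s xs = ys.
Proof.
elim: xs ys => [|x xs IH] [|y ys] //=; first by exists 1%g.
case/andP=> xNxs uxs /andP[yNys uys] [/(IH _ uxs uys)[s def_ys]].
(* The transposition redirects [x] to [y] and disturbs no value in [ys]: neither [s x] nor [y] lies
   there. *)
exists (s * tperm (s x) y)%g; rewrite permM tpermL; congr (_ :: _).
rewrite -[RHS]def_ys; apply/eq_in_map => z zxs; rewrite permM tpermD //.
  by apply: contraNneq xNxs => /perm_inj->.
by apply: contraNneq yNys => ->; rewrite -def_ys map_f.
Qed.

(** These permutations form a right coset of the pointwise stabilizer of [xs], that is, of the
    permutations supported off [xs]. *)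
Lemma card_perm_map_eq (T : finType) (xs ys : seq T) :
  uniq xs -> uniq ys -> size xs = size ys ->
  #|[set p : {perm T} | map p xs == ys]| = (#|T| - size xs)`!.
Proof.
move=> uxs uys eq_sz; have [s def_ys] := perm_map_exists uxs uys eq_sz.
rewrite -(card_uniqP uxs) -(cardC (mem xs)) addKn.
rewrite -[in RHS]cardsE -card_perm -[RHS](card_imset _ (mulIg s)).
apply: eq_card => p; rewrite inE; apply/eqP/imsetP => [map_p | [q q_on ->]].
  exists (p * s^-1)%g; last by rewrite mulgKV.
  apply/subsetP=> x; rewrite !inE; apply: contraNN => xxs.
  move: map_p; rewrite -def_ys => /eq_in_map/(_ x xxs) eq_px.
  by rewrite permM eq_px permK.
rewrite -def_ys; apply/eq_in_map => x xxs; rewrite permM (out_perm q_on) //.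
by rewrite !inE negbK.
Qed.

(** Sort the permutations by the image [t] of [xs], a duplicate-free tuple in [B]. Since [y] is
    outside [B], [y :: t] is duplicate-free too, so all fibres have the same size. *)
Lemma card_perm_point_tuple (T : finType) k x (xs : k.-tuple T) y (B : {set T}) :
  uniq (x :: xs) -> y \notin B ->
  #|[set p : {perm T} | (p x == y) && all [in B] (map p xs)]| =
    #|B| ^_ k * (#|T| - k.+1)`!.
Proof.
move=> uxs yNB; have /andP[_ uxs'] := uxs; rewrite -card_uniq_tuples.
rewrite -sum1_card
  (partition_big (fun p : {perm T} => map_tuple p xs)
     [in [set t : k.-tuple T | all [in B] t & uniq t]]) /=; last first.
  move=> p; rewrite !inE => /andP[_ ->].
  by rewrite map_inj_uniq //; apply: perm_inj.
rewrite -sum_nat_const; apply: eq_bigr => t; rewrite inE => /andP[Bt ut].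
have uyt : uniq (y :: t).
  by rewrite /= ut andbT; apply: contra yNB => /(allP Bt).
have <- : #|[set p : {perm T} | map p (x :: xs) == y :: t]| = (#|T| - k.+1)`!.
  by rewrite card_perm_map_eq /= ?size_tuple.
rewrite sum1_card; apply: eq_card => p; rewrite unfold_in !inE -andbA.
rewrite [RHS]eqseq_cons -[map_tuple p xs == t]/(map p xs == t :> seq T).
by case: eqP => //= _; rewrite andb_idl // => /eqP->.
Qed.

(** The rows allowed once the permutation matrix puts [l] at place [j0] of the window [w]. *)
Definition peak_perms r n (w : 'I_r -> 'I_n) (l : 'I_n) (j0 : 'I_r) : {set 'S_n} :=
  [set p : 'S_n | (p (w j0) == l) && [forall (j | j != j0), p (w j) < l]].

Lemma card_peak_perms r n (w : 'I_r -> 'I_n) l j0 :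
  injective w -> #|peak_perms w l j0| = l ^_ r.-1 * (n - r)`!.
Proof.
case: r w j0 => [|r] w j0 w_inj; first by case: j0.
have uxs : uniq (w j0 :: [tuple w (lift j0 j) | j < r]).
  rewrite /= map_inj_uniq ?enum_uniq ?andbT; last first.
    by move=> i j /w_inj/lift_inj.
  by apply/mapP=> -[j _ /w_inj/eqP]; rewrite (negPf (neq_lift j0 j)).
have lNB : l \notin [set m : 'I_n | m < l] by rewrite inE ltnn.
have cardB : #|[set m : 'I_n | m < l]| = l.
  rewrite -sum1dep_card (big_ord_narrow (ltnW (ltn_ord l))) sum1_card.
  by rewrite card_ord.
rewrite -[in RHS]cardB -[in n - _](card_ord n) -(card_perm_point_tuple uxs lNB).
apply: eq_card => p; rewrite !inE; congr (_ && _).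
apply/forall_inP/allP => [below x | below j].
  by case/mapP=> _ /mapP[j _ ->] ->; rewrite inE below // eq_sym neq_lift.
rewrite eq_sym => /unlift_some[j' -> _].
have := below (p (w (lift j0 j'))); rewrite inE; apply.
by do 2!apply: map_f; rewrite mem_enum.
Qed.

Section Window.

Variables (r n : nat) (w : 'I_r -> 'I_n).
Hypothesis w_inj : injective w.
Implicit Types (Pi : {ffun 'I_r -> 'S_n}) (l : 'I_n) (s : 'S_r).

Lemma all_level_eq_exists Pi l :
  [forall j, \max_(k < r) Pi k (w j) == l] =
  [exists s : 'S_r, Pi \in family (fun k => peak_perms w l (s k))].
Proof.
apply/forallP/existsP => [levPi | [s /familyP fam] j].
  have /fin_all_exists[t def_t] j : exists k, Pi k (w j) = l.
    have [|k max_k] := @eq_bigmax _ (fun k => Pi k (w j) : nat).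
      (* Rows and window places share the type ['I_r], so [j] shows that there is a row and the
         maximum is attained. *)
      by apply/card_gt0P; exists j.
    by exists k; apply/val_inj; rewrite /= -max_k; apply/eqP.
  have t_inj : injective t.
    move=> j j' eq_t; apply/w_inj/(@perm_inj _ (Pi (t j))).
    by rewrite def_t eq_t def_t.
  (* [t] sends a place to the row holding [l] there; [s] must go from rows to places. *)
  exists (perm t_inj)^-1%g; apply/familyP => k; rewrite inE.
  set j0 := (perm t_inj)^-1%g k; have def_k : t j0 = k.
    by rewrite -[LHS](permE t_inj) permKV.
  rewrite -{1}def_k def_t eqxx; apply/forall_inP => j neq_j.
  rewrite ltn_neqAle; apply/andP; split; last first.
    by rewrite -(eqP (levPi j)); apply: leq_bigmax.
  apply: contraNneq neq_j => eq_l; apply/eqP/w_inj/(@perm_inj _ (Pi k)).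
  by rewrite -{2}def_k def_t; apply: val_inj.
have peak k : Pi k (w (s k)) = l.
  by have := fam k; rewrite inE => /andP[/eqP].
rewrite eqn_leq; apply/andP; split; last first.
  apply: leq_trans (leq_bigmax (s^-1%g j)).
  by rewrite -{2}[j](permKV s) peak.
apply/bigmax_leqP => k _; have := fam k; rewrite inE => /andP[_ /forall_inP below].
by have [-> | /below/ltnW //] := eqVneq j (s k); rewrite peak.
Qed.

(** The matrix [s] is determined by [Pi], as each row takes the value [l] only once. So one may sum
    over [s], and for fixed [s] multiply over the rows. *)
Lemma card_all_level l :
  #|[set Pi : {ffun 'I_r -> 'S_n} | [forall j, \max_(k < r) Pi k (w j) == l]]| =
    r`! * (l ^_ r.-1 * (n - r)`!) ^ r.
Proof.
rewrite -sum1dep_card big_mkcond /=.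
under eq_bigr => Pi _.
  rewrite -[if _ then _ else _]/(nat_of_bool _) all_level_eq_exists.
  rewrite -sum_pred_exists; last first.
    move=> s s' /familyP fam /familyP fam'; apply/permP => k.
    apply/w_inj/(@perm_inj _ (Pi k)).
    by have := fam k; have := fam' k; rewrite !inE => /andP[/eqP-> _] /andP[/eqP].
  over.
rewrite exchange_big /= -card_Sn -sum_nat_const; apply: eq_bigr => s _.
rewrite -big_mkcond sum1_card card_family foldrE big_map big_enum /=.
under eq_bigr do rewrite card_peak_perms //.
by rewrite prod_nat_const card_ord.
Qed.

Lemma card_constant_level : 0 < r ->
  #|[set Pi : {ffun 'I_r -> 'S_n} |
      [forall j, forall j', \max_(k < r) Pi k (w j) == \max_(k < r) Pi k (w j')]]| =
    \sum_(l < n) r`! * (l ^_ r.-1 * (n - r)`!) ^ r.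
Proof.
move=> r_gt0; pose j0 := Ordinal r_gt0.
under [RHS]eq_bigr => l _ do rewrite -card_all_level -sum1dep_card big_mkcond.
rewrite exchange_big -sum1dep_card big_mkcond; apply: eq_bigr => Pi _ /=.
rewrite -[LHS]/(nat_of_bool _).
rewrite (sum_pred_exists (P := fun l : 'I_n => [forall j, _ == l :> nat])).
  congr nat_of_bool; apply/forallP/existsP => [const | [l /forallP lev_l] j].
    have [|k max_k] := @eq_bigmax _ (fun k => Pi k (w j0) : nat).
      by apply/card_gt0P; exists j0.
    (* The common level is an entry of column [j0], hence an element of ['I_n]. *)
    exists (Pi k (w j0)); apply/forallP => j.
    by rewrite -max_k (forallP (const j)).
  by apply/forallP => j'; rewrite (eqP (lev_l j)) eq_sym.
move=> l l' /forallP/(_ j0)/eqP eq_l /forallP/(_ j0)/eqP eq_l'.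
by apply: val_inj; rewrite /= -eq_l eq_l'.
Qed.

End Window.

Lemma card_plateau_at n d i : 2 <= d -> i + (d - 1) <= n ->
  #|[set Pi : multiperm d n | plateau_at Pi i]| =
    (d - 1)`! * (n + 1 - d)`! ^ (d - 1) * \sum_(0 <= l < n) arr l (d - 2) ^ (d - 1).
Proof.
move=> d_ge2 le_n.
have lt_n (j : 'I_(d - 1)) : i + j < n by apply: leq_trans le_n; rewrite ltn_add2l.
pose w j := Ordinal (lt_n j).
have w_inj : injective w by move=> j j' [/addnI/val_inj].
have levE (Pi : multiperm d n) x :
    lev (column Pi x) = \max_(k < d - 1) Pi k x.
  by apply: eq_bigr => k _; rewrite ffunE.
(* The positions tested by [plateau_at] are exactly the image of [w]. *)
have wP (x : 'I_n) : i <= x < i + (d - 1) -> exists j, x = w j.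
  case/andP=> le_ix lt_x.
  have lt_j : x - i < d - 1 by rewrite ltn_subLR.
  by exists (Ordinal lt_j); apply: val_inj; rewrite /= subnKC.
have d1_gt0 : 0 < d - 1 by rewrite subn_gt0.
transitivity (\sum_(l < n) (d - 1)`! * (l ^_ (d - 1).-1 * (n - (d - 1))`!) ^ (d - 1)).
  rewrite -(card_constant_level w_inj d1_gt0); apply: eq_card => Pi; rewrite !inE.
  apply/forallP/forallP => const x; apply/forallP => x'.
    have := forallP (const (w x)) (w x').
    by rewrite !levE /= !leq_addr !ltn_add2l !ltn_ord.
  apply/implyP => /andP[/wP[j ->] /wP[j' ->]].
  by rewrite !levE; apply: (forallP (const j)).
rewrite big_mkord big_distrr /=; apply: eq_bigr => l _.
rewrite arrE expnMn subnBA 1?ltnW // -subnS.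
by rewrite -mulnA [_ ^ _ * _]mulnC.
Qed.

Theorem theorem3p15 (n d : nat) (hn : 2 <= n) (hd : 2 <= d) (hnd : d - 1 <= n) :
  \sum_(Pi : multiperm d n) nb_plateaux Pi =
  (n + 2 - d) * (d - 1)`! * (n + 1 - d)`! ^ (d - 1) *
    \sum_(0 <= l < n) arr l (d - 2) ^ (d - 1).
Proof.
transitivity (\sum_(Pi : multiperm d n) \sum_(i < n + 2 - d) plateau_at Pi i).
  by apply: eq_bigr => Pi _; rewrite /nb_plateaux -sum1dep_card big_mkcond.
(* Count by starting index: each of the [n + 2 - d] indices contributes equally. *)
rewrite exchange_big /= -!mulnA -[X in X * _]card_ord -sum_nat_const.
apply: eq_bigr => i _; rewrite -big_mkcond sum1dep_card.
rewrite card_plateau_at // ?mulnA //.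
(* It remains to see that the window starting at [i] fits inside ['I_n]. *)
have := ltn_ord i; rewrite ltn_subRL (addnBA _ (ltnW hd)) leq_subLR.
by move: (nat_of_ord i) => m; rewrite addn2 ltnS addnC.
Qed.
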